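(* Let $q$ and $z$ be indeterminates. For every integer $L\ge 0$, $$\sum_{i,j\ge 0} q^{T_i+T_j}(-z^2)^j\begin{bmatrix}L-j\\ i\end{bmatrix}_q\begin{bmatrix}i\\ j\end{bmatrix}_q=\sum_{i,j,k\ge 0}(-1)^j z^{i+j}q^{T_i+T_j+T_k}\begin{bmatrix}L-i\\ j\end{bmatrix}_q\begin{bmatrix}L-j\\ k\end{bmatrix}_q\begin{bmatrix}L-k\\ i\end{bmatrix}_q .$$
   Context: Notation: $T_n=\frac{n(n+1)}{2}$. For an integer $N\ge 0$, $(a)_N=(a;q)_N=\prod_{j=0}^{N-1}(1-aq^j)$ with $(a)_0=1$. The $q$-binomial coefficient is defined by $\begin{bmatrix}n+m\\ n\end{bmatrix}_q=\frac{(q)_{n+m}}{(q)_n(q)_m}$ if $n,m\ge 0$, and $0$ otherwise; i.e. $\begin{bmatrix}M\\ n\end{bmatrix}_q=0$ unless $0\le n\le M$. Thus both sums are finite. *)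

(* Defs.v *)
From HB Require Import structures.
From mathcomp Require Import all_boot all_order all_algebra.
From mathcomp Require Import classical_sets fsbigop.

Set Implicit Arguments.
Unset Strict Implicit.
Unset Printing Implicit Defensive.

Import Order.TTheory GRing.Theory Num.Theory.

Local Open Scope ring_scope.

Definition tri (n : nat) : nat := ((n * n.+1) %/ 2)%N.

Definition qpoch (F : fieldType) (a q : F) (N : nat) : F :=
  \prod_(j < N) (1 - a * q ^+ j).

(* The upper and lower entries are integers: the upper entry may be a genuinely
   negative difference such as L - j with j > L, and the coefficient is then 0.
   The quotient has its usual meaning when q is not a root of unity, as for the
   indeterminate [qv] below. *)
Definition qbinom (F : fieldType) (q : F) (M n : int) : F :=
  if (0 <= n) && (n <= M) then
    qpoch q q `|M|%N / (qpoch q q `|n|%N * qpoch q q `|M - n|%N)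
  else 0.

(* The field Q(q, z), as the fractions of Q[q][z]. *)
Definition Qqz : fieldType := {fraction {poly {poly rat}}}.
Definition qv : Qqz := tofrac ('X%:P : {poly {poly rat}}).
Definition zv : Qqz := tofrac ('X : {poly {poly rat}}).

(* Main.v *)
Require Import Defs.
From HB Require Import structures.
From mathcomp Require Import all_boot all_order all_algebra.
From mathcomp Require Import classical_sets fsbigop.
From mathcomp Require Import zify ring.

Import Order.TTheory GRing.Theory Num.Theory.

Local Open Scope classical_set_scope.
Local Open Scope ring_scope.

(** The two sides are compared coefficientwise in [z].  Write T for [tri],
    (q)_n for [qpoch q q n], (-q)_n for the product of the 1 + q^r with
    1 <= r <= n, and [n, k] for the q-binomial coefficient.

    Left-hand side.  Only even powers of [z] occur, and the q-binomial theorem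
    sums the series in i: the coefficient of z^(2m) is
    (-1)^m q^(m(m+1)) [L-m, m] (-q)_(L-m) / (-q)_m   ([coef_form], [left_coefE]).

    Right-hand side.  Let n = i + j and d = L - n.  The sum over k is a
    terminating 2phi1 series; its Euler-Heine transformation
    ([cyclic_inner_sum]), here a consequence of the q-Pfaff-Saalschuetz sum
    [q_Saalschutz], makes it, after multiplication by [L-i, j], symmetric in
    i and j:
      (-q)_d sum_s q^(T_s + sd) (q)_(L-s) / ((q)_s (q)_(i-s) (q)_(j-s) (q)_d).
    Shifting i and j by s leaves, as the sum over i + j = n weighted by the
    signs (-1)^j, the alternating sum [gsum] of length N = n - 2s, which is a
    normalised coefficient of (xq)(-xq) = (x^2 q^2; q^2), both infinite
    products: it vanishes for N odd and is a product for N even.  So the odd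
    powers of [z] disappear.  For n = 2m the exponents of q no longer depend
    on s except through T_s + sd, and the remaining sum over s is evaluated
    by the q-Chu-Vandermonde formula ([diagonal_sum]); the result is again
    [coef_form].

    All identities are proved over a field in which no positive power of q
    equals 1, without negative powers of q: hypergeometric parameters such as
    -q^(-m) are replaced by homogeneous ones. *)

(** * Triangular numbers and q-binomial coefficients *)

Lemma triS n : tri n.+1 = (tri n + n.+1)%N.
Proof.
rewrite /tri (_ : (n.+1 * n.+2 = n.+1 * 2 + n * n.+1)%N); last by lia.
by rewrite divnMDl // addnC.
Qed.

Lemma tri_double n : ((tri n).*2 = n * n.+1)%N.
Proof. by elim: n => // n IH; rewrite triS doubleD IH; lia. Qed.

Lemma triD a b : tri (a + b) = (tri a + tri b + a * b)%N.
Proof.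
elim: b => [|b IH]; first by rewrite muln0 !addn0.
by rewrite addnS !triS IH; lia.
Qed.

Section Qbin.

Set Implicit Arguments.
Unset Strict Implicit.

Variables (F : fieldType) (q : F).
Hypothesis q_not1 : forall n, 1 - q ^+ n.+1 != 0.

Local Notation qfact := (qpoch q q).
Local Notation qbin n k := (qbinom q (Posz n) (Posz k)).

Lemma qfactS n : qfact n.+1 = qfact n * (1 - q ^+ n.+1).
Proof. by rewrite /qpoch big_ord_recr /= exprS. Qed.

Lemma qfact0 : qfact 0 = 1.
Proof. exact: big_ord0. Qed.

Lemma qfact_neq0 n : qfact n != 0.
Proof. by apply/prodf_neq0 => j _; rewrite -exprS. Qed.

Lemma qbinD a b : qbin (a + b) a = qfact (a + b) / (qfact a * qfact b).
Proof.
rewrite /qbinom !lez_nat leq_addr /=.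
by have -> : `|Posz (a + b) - Posz a|%N = b by lia.
Qed.

Lemma qbinE n k : (k <= n)%N -> qbin n k = qfact n / (qfact k * qfact (n - k)).
Proof. by move=> kn; rewrite -{1}(subnKC kn) qbinD subnKC. Qed.

Lemma qbin_small n k : (n < k)%N -> qbin n k = 0.
Proof. by move=> nk; rewrite /qbinom !lez_nat [(k <= n)%N]leqNgt nk andbF. Qed.

Lemma qbinn0 n : qbin n 0 = 1.
Proof. by rewrite (qbinD 0 n) qfact0 mul1r divff // qfact_neq0. Qed.

Lemma qbinnn n : qbin n n = 1.
Proof. by have := qbinD n 0; rewrite addn0 qfact0 mulr1 divff ?qfact_neq0. Qed.

Lemma qbin_pascal n k : qbin n.+1 k.+1 = q ^+ (n - k) * qbin n k + qbin n k.+1.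
Proof.
have [kn|nk|->] := ltngtP k n; last first.
- by rewrite subnn !qbinnn qbin_small // mulr1 addr0.
- by rewrite !qbin_small ?mulr0 ?addr0 //; lia.
have kn' := ltnW kn; rewrite !qbinE //.
rewrite subSS; have -> : (n - k = (n - k.+1).+1)%N by lia.
rewrite !qfactS.
have -> : q ^+ n.+1 = q ^+ k.+1 * q ^+ (n - k.+1).+1.
  by rewrite -exprD; congr (_ ^+ _); lia.
by have qf := qfact_neq0; have q1 := q_not1; field; rewrite !qf !q1.
Qed.

(** * Manipulation of finite sums *)

Lemma sum_ord_widen (f : nat -> F) m n :
  (m <= n)%N -> (forall t, (m <= t < n)%N -> f t = 0) ->
  \sum_(t < n) f t = \sum_(t < m) f t.
Proof.
move=> mn f0; rewrite -(subnKC mn) big_split_ord /= [X in _ + X]big1 ?addr0 //.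
by move=> t _; apply: f0; have := ltn_ord t; lia.
Qed.

Lemma sum_triangle (f : nat -> nat -> F) K :
  \sum_(n < K) \sum_(i < n.+1) f i (n - i)%N = \sum_(i < K) \sum_(j < K - i) f i j.
Proof.
elim: K => [|K IH]; first by rewrite !big_ord0.
rewrite big_ord_recr /= IH [RHS]big_ord_recr /= subSnn big_ord1 big_ord_recr /= addrA.
rewrite -big_split /= subnn; congr (_ + _); apply: eq_bigr => i _.
by rewrite subSn ?big_ord_recr // ltnW.
Qed.

Lemma qbin_sum_pascal (f : nat -> F) d :
  \sum_(t < d.+2) f t * qbin d.+1 t =
  \sum_(t < d.+1) (f t + q ^+ (d - t) * f t.+1) * qbin d t.
Proof.
rewrite big_ord_recl /=.
under eq_bigr do rewrite qbin_pascal mulrDr.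
rewrite big_split /= addrCA addrC.
have -> : f 0 * qbin d.+1 0 + \sum_(i < d.+1) f i.+1 * qbin d i.+1 =
  \sum_(t < d.+1) f t * qbin d t.
  rewrite [RHS]big_ord_recl /= big_ord_recr /= [qbin d d.+1]qbin_small // mulr0 addr0.
  by rewrite !qbinn0.
by rewrite -big_split; apply: eq_bigr => t _ /=; ring.
Qed.

(** * Classical q-summations *)

Lemma q_binomial x d :
  \sum_(t < d.+1) x ^+ t * q ^+ tri t * qbin d t = \prod_(r < d) (1 + x * q ^+ r.+1).
Proof.
elim: d => [|d IH]; first by rewrite big_ord_recr !big_ord0 /= qbinn0 add0r !mulr1.
rewrite (qbin_sum_pascal (fun t => x ^+ t * q ^+ tri t)) [RHS]big_ord_recr /= -IH mulr_suml.
apply: eq_bigr => -[t /= td] _.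
have -> : q ^+ d.+1 = q ^+ (d - t) * q ^+ t.+1 by rewrite -exprD; congr (_ ^+ _); lia.
by rewrite triS exprD !exprS; ring.
Qed.

(** The bound [N] is left free so that the same formula serves sums cut at
    either of the two places where the terms vanish; the condition [s <= k]
    discards the indices at which the truncated [k - s] is spurious. *)
Lemma q_Vandermonde m n k N : (minn n k <= N)%N ->
  qbin (m + n) k =
  \sum_(s < N.+1 | (s <= k)%N) q ^+ (s * (m - (k - s))) * qbin m (k - s) * qbin n s.
Proof.
move=> nkN.
pose f k s := if (s <= k)%N then q ^+ (s * (m - (k - s))) * qbin m (k - s) else 0.
transitivity (\sum_(s < n.+1) f k s * qbin n s); last first.
  rewrite [RHS]big_mkcond /=.
  transitivity (\sum_(s < N.+1) f k s * qbin n s); last first.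
    by apply: eq_bigr => s _; rewrite /f; case: ifP; rewrite ?mul0r.
  have f0 t : (minn n k < t)%N -> f k t * qbin n t = 0.
    rewrite gtn_min => /orP[/qbin_small->|kt]; first by rewrite mulr0.
    by rewrite /f leqNgt kt mul0r.
  rewrite (@sum_ord_widen (fun t => f k t * qbin n t) (minn n k).+1) ?ltnS ?geq_minl //.
    rewrite [RHS](@sum_ord_widen (fun t => f k t * qbin n t) (minn n k).+1) ?ltnS //.
    by move=> t /andP[/f0].
  by move=> t /andP[/f0].
(* Extending the summand by 0 for [s > k] lets Pascal's rule act termwise. *)
elim: n k {N nkN} => [|n IH] k.
  by rewrite big_ord1 addn0 /f /= mul1r subn0 qbinn0 mulr1.
rewrite (qbin_sum_pascal (f k)) addnS.
case: k => [|k].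
  rewrite !qbinn0 -(qbinn0 (m + n)) IH; apply: eq_bigr => s _.
  by rewrite [X in _ + _ * X]/f /= mulr0 addr0.
rewrite qbin_pascal addrC !IH mulr_sumr -big_split; apply: eq_bigr => -[s /= sn] _.
rewrite mulrDl; congr (_ + _); rewrite mulrA; congr (_ * _).
rewrite /f ltnS subSS; case: ifP => [sk|_]; last by rewrite !mulr0.
have [ksm|mks] := leqP (k - s) m; last by rewrite qbin_small // !mulr0.
by rewrite !mulrA -!exprD; congr (_ ^+ _ * _); nia.
Qed.

(** The q-Pfaff-Saalschuetz sum.  The last factor is expanded by
    q-Vandermonde according to i+j+d-s = (i+j+d-k) + (k-s); the sum over s, and
    then the sum over the new index r, are again q-Vandermonde sums, once the
    products of two q-binomial coefficients are regrouped. *)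
Lemma q_Saalschutz i j d k : (k <= i + d)%N ->
  qbin (i + d) k * qbin (i + j + d - k) i =
  \sum_(s < k.+1) q ^+ (s * (d - (k - s))) * qbin d (k - s) * qbin j s
                  * qbin (i + j + d - s) (j + d).
Proof.
move=> kid; set L := (i + j + d)%N.
transitivity (\sum_(s < k.+1) \sum_(r < k.+1 | (r <= j + d)%N)
   (q ^+ (r * (i - (k - r))) * qbin (L - k) (j + d - r)) *
   (q ^+ (s * (d - (k - s))) * qbin d (k - s) * qbin (k - s) r * qbin j s)); last first.
  apply: eq_bigr => -[s /= sk] _.
  have -> : (L - s = (L - k) + (k - s))%N by lia.
  rewrite (@q_Vandermonde (L - k) (k - s) _ k); last by lia.
  rewrite mulr_sumr; apply: eq_bigr => -[r /= rk] rjd.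
  have [rLk|rLk] := leqP (j + d - r) (L - k); last by rewrite (qbin_small rLk) !(mulr0, mul0r).
  have -> : (L - k - (j + d - r) = i - (k - r))%N by lia.
  by ring.
rewrite exchange_big /=.
(* The sum over [s], for a fixed index [r] of the expansion. *)
have inner (r : nat) : (r <= k)%N ->
   \sum_(s < k.+1) q ^+ (s * (d - (k - s))) * qbin d (k - s) * qbin (k - s) r * qbin j s
   = qbin d r * qbin (j + d - r) (k - r).
  move=> rk; have [rd|dr] := leqP r d; last first.
    rewrite (qbin_small dr) mul0r big1 // => -[s /= sk] _.
    have [ksd|dks] := leqP (k - s) d; last by rewrite (qbin_small dks) !(mulr0, mul0r).
    by rewrite (@qbin_small _ r) ?mulr0 ?mul0r //; lia.
  have -> : (j + d - r = (d - r) + j)%N by lia.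
  rewrite (@q_Vandermonde _ j _ k); last by lia.
  rewrite mulr_sumr [RHS]big_mkcond; apply: eq_bigr => -[s /= sk] _.
  case: ifP => skr; last by rewrite (@qbin_small _ r) ?mulr0 ?mul0r //; lia.
  have [ksd|dks] := leqP (k - s) d; last first.
    by rewrite (qbin_small dks) (@qbin_small (d - r)) ?(mulr0, mul0r) //; lia.
  have -> : (d - r - (k - r - s) = d - (k - s))%N by lia.
  rewrite [qbin d (k - s)]qbinE // [qbin (k - s) r]qbinE; last by lia.
  rewrite [qbin d r]qbinE // [qbin (d - r) _]qbinE; last by lia.
  have -> : (k - r - s = k - s - r)%N by lia.
  have -> : (d - r - (k - s - r) = d - (k - s))%N by lia.
  by have := qfact_neq0 => qf; field; rewrite !qf.
rewrite (@q_Vandermonde i d k k) ?geq_minr //.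
rewrite mulr_suml big_mkcond [RHS]big_mkcond; apply: eq_bigr => -[r /= rk] _.
rewrite -(ltnS r k) rk -mulr_sumr inner //.
case: leqP => rjd; last by rewrite (@qbin_small d r) ?(mulr0, mul0r) //; lia.
have [kri|kri] := leqP (k - r) i; last first.
  by rewrite (qbin_small kri) (@qbin_small (L - k) (j + d - r)) ?(mulr0, mul0r) //; lia.
have [kjd|kjd] := leqP k (j + d); last first.
  by rewrite (@qbin_small (L - k) i) 1?(@qbin_small (j + d - r) (k - r))
    ?(mulr0, mul0r) //; lia.
rewrite [qbin (L - k) i]qbinE; last by lia.
rewrite [qbin (L - k) _]qbinE; last by lia.
rewrite [qbin i _]qbinE // [qbin (j + d - r) _]qbinE; last by lia.
have -> : (L - k - (j + d - r) = i - (k - r))%N by lia.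
have -> : (j + d - r - (k - r) = L - k - i)%N by lia.
by have := qfact_neq0 => qf; field; rewrite !qf.
Qed.

(** The Euler-Heine transformation: inserting [q_Saalschutz] and writing
    k = s + t decouples the sums, because
    T_(s+t) + s(d-t) = T_s + T_t + sd, and the sum over t is (-q)_d. *)
Lemma cyclic_inner_sum i j d :
  \sum_(k < (i + d).+1) q ^+ tri k * qbin (i + d) k * qbin (i + j + d - k) i =
  \prod_(r < d) (1 + q ^+ r.+1) *
  \sum_(s < i.+1) q ^+ (tri s + s * d) * qbin j s * qbin (i + j + d - s) (j + d).
Proof.
pose g s := q ^+ (tri s + s * d) * qbin j s * qbin (i + j + d - s) (j + d).
pose f s t := g s * (q ^+ tri t * qbin d t).
transitivity (\sum_(k < (i + d).+1) \sum_(s < k.+1) f s (k - s)%N).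
  apply: eq_bigr => -[k /= kid] _; rewrite -mulrA q_Saalschutz // mulr_sumr.
  apply: eq_bigr => -[s /= sk] _; rewrite /f /g.
  have [ksd|dks] := leqP (k - s) d; last by rewrite (qbin_small dks) !(mulr0, mul0r).
  have E : (tri k + s * (d - (k - s)) = tri s + s * d + tri (k - s))%N.
    by rewrite -{1}(subnKC (_ : s <= k)%N) // triD; nia.
  have -> : forall x y z : F,
    q ^+ tri k * (q ^+ (s * (d - (k - s))) * x * y * z) =
    q ^+ (tri k + s * (d - (k - s))) * x * y * z by move=> *; rewrite exprD; ring.
  by rewrite E exprD; ring.

rewrite (sum_triangle f).
have dist : \prod_(r < d) (1 + q ^+ r.+1) = \sum_(t < d.+1) q ^+ tri t * qbin d t.
  under eq_bigr do rewrite -[q ^+ _]mul1r.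
  by rewrite -q_binomial; apply: eq_bigr => t _; rewrite expr1n mul1r.
rewrite dist mulrC mulr_suml -addSn.
rewrite (@sum_ord_widen (fun s => \sum_(t < (i.+1 + d) - s) f s t) i.+1) ?leq_addr //;
  last first.
  move=> s /andP[si sid]; apply: big1 => t _; rewrite /f /g.
  have [sj|js] := leqP s j; last by rewrite (qbin_small js) !(mulr0, mul0r).
  by rewrite (@qbin_small _ (j + d)) ?(mulr0, mul0r) //; lia.
apply: eq_bigr => -[s /= si] _; rewrite (@sum_ord_widen (f s) d.+1); last 2 first.
- by lia.
- by move=> t /andP[dt _]; rewrite /f (qbin_small dt) !mulr0.
by rewrite mulr_sumr.
Qed.


(** * An alternating sum of Gauss type *)

(** (q)_N times the coefficient of x^N in the product of the infinite
    products (-xq) and (xq). *)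
Definition gsum N : F :=
  \sum_(a < N.+1) (-1) ^+ (N - a) * q ^+ (tri a + tri (N - a)) * qbin N a.

(** The companion of [gsum] that Pascal's rule produces. *)
Definition gsum_twist N : F :=
  \sum_(a < N.+1) (-1) ^+ (N - a) * q ^+ (tri a + tri (N - a) + (N - a)) * qbin N a.

Lemma gsumS N : gsum N.+1 = q ^+ N.+1 * gsum N - q * gsum_twist N.
Proof.
rewrite /gsum (qbin_sum_pascal (fun a => (-1) ^+ (N.+1 - a) * q ^+ (tri a + tri (N.+1 - a)))).
rewrite !mulr_sumr -sumrB; apply: eq_bigr => -[a /= aN] _.
rewrite subSn // subSS !triS.
have -> : q ^+ N.+1 = q ^+ (N - a) * q ^+ a.+1 by rewrite -exprD; congr (_ ^+ _); lia.
by rewrite !exprD !exprS; ring.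
Qed.

(** Two linear relations between [gsum] and [gsum_twist] at consecutive
    indices, one from Pascal's rule and one from
    (1 - q^(N+1-a)) [N+1, a] = (1 - q^(N+1)) [N, a], eliminate the latter. *)
Lemma gsum_rec N : gsum N.+2 = - q ^+ N.+2 * (1 - q ^+ N.+1) * gsum N.
Proof.
have gS' : gsum N.+1 - gsum_twist N.+1 = - (1 - q ^+ N.+1) * (q * gsum_twist N).
  rewrite /gsum /gsum_twist -sumrB big_ord_recr /= subnn addn0 subrr addr0 !mulr_sumr.
  apply: eq_bigr => -[a /= aN] _.
  have qf := qfact_neq0; have q1 := q_not1.
  rewrite !qbinE //; last by lia.
  rewrite subSn // !triS !qfactS !exprD !exprS.
  by field; rewrite !qf -exprS q1.
have E : gsum_twist N.+1 = gsum N.+1 + (1 - q ^+ N.+1) * (q * gsum_twist N).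
  by rewrite -[LHS](subKr (gsum N.+1)) gS'; ring.
have E' : q * gsum_twist N = q ^+ N.+1 * gsum N - gsum N.+1.
  by rewrite gsumS; ring.
by rewrite gsumS E E' !exprS; ring.
Qed.

Lemma gsum_odd M : gsum (M.*2).+1 = 0.
Proof.
elim: M => [|M IH]; last by rewrite doubleS gsum_rec IH mulr0.
by rewrite /gsum big_ord_recr big_ord1 /= qbinn0 qbinnn !mulr1 /= expr0 expr1; ring.
Qed.

Lemma gsum_even M :
  gsum M.*2 = (-1) ^+ M * q ^+ (M * M.+1) * \prod_(r < M) (1 - q ^+ r.*2.+1).
Proof.
elim: M => [|M IH]; first by rewrite /gsum big_ord1 big_ord0 qbinn0 !mulr1.
rewrite doubleS gsum_rec IH big_ord_recr /=.
have -> : (M.+1 * M.+2 = M * M.+1 + M.*2.+2)%N by lia.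
by rewrite exprD [(-1) ^+ M.+1]exprS; ring.
Qed.

(** * The q-Chu-Vandermonde formula and the diagonal sum *)

(** The usual form has c = 1; the homogeneous parameter [c] allows b/c to be
    -q^(-m) with no negative power. *)
Lemma q_Chu_Vandermonde A b c m :
  \sum_(s < m.+1) A ^+ s * \prod_(r < s) (c - b * q ^+ r)
      * \prod_(r < m - s) (1 - A * c * q ^+ r) * qbin m s
  = \prod_(r < m) (1 - A * b * q ^+ r).
Proof.
elim: m => [|m IH]; first by rewrite big_ord1 !big_ord0 qbinn0 !mulr1.
rewrite (qbin_sum_pascal (fun s => A ^+ s * \prod_(r < s) (c - b * q ^+ r)
      * \prod_(r < m.+1 - s) (1 - A * c * q ^+ r))).
rewrite [RHS]big_ord_recr /= -IH mulr_suml; apply: eq_bigr => -[s /= sm] _.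
rewrite subSS subSn // !big_ord_recr /=.
have -> : q ^+ m = q ^+ (m - s) * q ^+ s by rewrite -exprD subnK.
by rewrite !exprS; ring.
Qed.


Local Notation qplus n := (\prod_(r < n%N) (1 + q ^+ r.+1)).

Lemma qplus_neq0 n : qplus n != 0.
Proof.
apply/prodf_neq0 => r _; have := q_not1 (r + r.+1).
have -> : 1 - q ^+ (r + r.+1).+1 = (1 - q ^+ r.+1) * (1 + q ^+ r.+1).
  by rewrite -addSn exprD; ring.
by rewrite mulf_eq0 negb_or => /andP[].
Qed.

Lemma qplusD m d : qplus (m + d) = qplus m * \prod_(r < d) (1 + q ^+ (m + r).+1).
Proof. by rewrite big_split_ord. Qed.

Lemma qfactD m d : qfact (m + d) = qfact m * \prod_(r < d) (1 - q ^+ (m + r).+1).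
Proof.
elim: d => [|d IH]; first by rewrite addn0 big_ord0 mulr1.
by rewrite addnS qfactS IH big_ord_recr /= mulrA.
Qed.

Lemma qfact_double M :
  qfact M.*2 = \prod_(r < M) (1 - q ^+ r.*2.+1) * qfact M * qplus M.
Proof.
elim: M => [|M IH]; first by rewrite !big_ord0 qfact0 !mulr1.
rewrite doubleS !qfactS IH !big_ord_recr /=.
have -> : q ^+ M.*2.+2 = q ^+ M.+1 * q ^+ M.+1 by rewrite -exprD; congr (_ ^+ _); lia.
by ring.
Qed.

Lemma prod_qpow_sum m s : (s <= m)%N ->
  qplus (m - s) * (q ^+ s * \prod_(r < s) (q ^+ m + q ^+ r)) = q ^+ tri s * qplus m.
Proof.
elim: s => [|s IH] sm; first by rewrite subn0 big_ord0 (_ : tri 0 = 0%N) // !(mul1r, mulr1).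
have E : (m - s = (m - s.+1).+1)%N by lia.
rewrite triS exprD mulrAC -IH; last by lia.
rewrite E !big_ord_recr /= -E.
have -> : q ^+ m = q ^+ s * q ^+ (m - s) by rewrite -exprD; congr (_ ^+ _); lia.
by rewrite exprS; ring.
Qed.

(** This is [q_Chu_Vandermonde] with A = q^(d+1), b = -1, c = q^m: both
    summands agree up to the factor (q)_(m+d) / ((q)_d (q)_m (-q)_m), by
    (q)_(2M) = (q; q^2)_M (q)_M (-q)_M. *)
Lemma diagonal_sum m d :
  qplus d * \sum_(s < m.+1) q ^+ (tri s + s * d) * qbin (m.*2 + d - s) s
     * qbin (m.*2 + d - s.*2) d * \prod_(r < m - s) (1 - q ^+ r.*2.+1)
  = qbin (m + d) m * \prod_(r < d) (1 + q ^+ (m + r).+1).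
Proof.
have qf := qfact_neq0; have qp := qplus_neq0.
have := q_Chu_Vandermonde (q ^+ d.+1) (-1) (q ^+ m) m.
have -> : \prod_(r < m) (1 - q ^+ d.+1 * -1 * q ^+ r) = qplus (d + m) / qplus d.
  rewrite qplusD [RHS]mulrC mulKf //; apply: eq_bigr => r _.
  by rewrite -addSn exprD; ring.
move=> CV.
have -> : \prod_(r < d) (1 + q ^+ (m + r).+1) = qplus (m + d) / qplus m.
  by rewrite qplusD [RHS]mulrC mulKf.
rewrite qbinD.
transitivity (qplus d * (qfact (m + d) / (qfact d * qfact m * qplus m)
   * (qplus (d + m) / qplus d))); last first.
  by rewrite (addnC d); field; rewrite !qf !qp.
rewrite -CV; congr (_ * _); rewrite mulr_sumr; apply: eq_bigr => -[s /= sm] _.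
have E := prod_qpow_sum (sm : (s <= m)%N).
have -> : \prod_(r < s) (q ^+ m - -1 * q ^+ r) = \prod_(r < s) (q ^+ m + q ^+ r).
  by apply: eq_bigr => r _; ring.
have -> : \prod_(r < m - s) (1 - q ^+ d.+1 * q ^+ m * q ^+ r) =
    qfact (m.*2 + d - s) / qfact (m + d).
  have -> : (m.*2 + d - s = (m + d) + (m - s))%N by lia.
  rewrite qfactD [RHS]mulrC mulKf //; apply: eq_bigr => r _.
  by rewrite -!exprD; congr (1 - q ^+ _); lia.
rewrite [qbin (m.*2 + d - s) s]qbinE; last by lia.
rewrite [qbin (m.*2 + d - s.*2) d]qbinE; last by lia.
rewrite [qbin m s]qbinE //.
have -> : (m.*2 + d - s - s = m.*2 + d - s.*2)%N by lia.
have -> : (m.*2 + d - s.*2 - d = (m - s).*2)%N by lia.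
have qo : \prod_(r < m - s) (1 - q ^+ r.*2.+1) != 0.
  by apply/prodf_neq0 => r _.
rewrite qfact_double -exprM.
have -> : (d.+1 * s = s * d + s)%N by lia.
have {}E : q ^+ tri s = qplus (m - s) * (q ^+ s * \prod_(r < s) (q ^+ m + q ^+ r)) / qplus m.
  by rewrite E mulfK.
rewrite !exprD E; field.
by rewrite !qf !qp qo.
Qed.


(** * Coefficients of the cyclic sum *)

Lemma sum_centered (f : nat -> F) s n : (s.*2 <= n)%N ->
  \sum_(i < n.+1) (if (s <= i)%N && (s <= n - i)%N then f i else 0) =
  \sum_(a < (n - s.*2).+1) f (s + a)%N.
Proof.
move=> sn; set N := (n - s.*2)%N; have -> : n = (s + N + s)%N by lia.
have -> : ((s + N + s).+1 = s + N.+1 + s)%N by lia.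
rewrite !big_split_ord /= big1 ?add0r => [|i _]; last first.
  by rewrite leqNgt ltn_ord.
rewrite [X in _ + X]big1 ?addr0 => [|i _]; last first.
  by have iB := ltn_ord i; case: ifP => // H; exfalso; lia.
by apply: eq_bigr => i _; have iB := ltn_ord i; case: ifP => // H; exfalso; lia.
Qed.

(** Both sides are the q-multinomial coefficient of i+j+d-s over
    (s, i-s, j-s, d). *)
Lemma qbin_multinomial i j d s : (s <= i)%N -> (s <= j)%N ->
  qbin (j + d) j * (qbin j s * qbin (i + j + d - s) (j + d)) =
  qbin (i + j + d - s) s * qbin (i + j + d - s.*2) d * qbin (i + j - s.*2) (i - s).
Proof.
move=> si sj; have qf := qfact_neq0.
rewrite [qbin (j + d) _]qbinD [qbin j s]qbinE // ![qbin (i + j + d - s) _]qbinE; try lia.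
rewrite [qbin (i + j + d - _) _]qbinE; last by lia.
rewrite [qbin _ (i - s)]qbinE; last by lia.
have -> : (i + j + d - s - s = i + j + d - s.*2)%N by lia.
have -> : (i + j + d - s - (j + d) = i - s)%N by lia.
have -> : (i + j + d - s.*2 - d = i + j - s.*2)%N by lia.
have -> : (i + j - s.*2 - (i - s) = j - s)%N by lia.
by field; rewrite !qf.
Qed.

(** The coefficient of z^n on the right-hand side, with j = n - i. *)
Definition cyclic_coef L n :=
  \sum_(i < n.+1) (-1) ^+ (n - i) * q ^+ (tri i + tri (n - i)) * qbin (L - i) (n - i)
    * \sum_(k < L.+1) q ^+ tri k * qbin (L - (n - i)) k * qbin (L - k) i.

(** In the double sum over i and s only s <= i <= n - s contributes, and
    there i = s + a, j = s + b with a + b = n - 2s; the sum over a is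
    [gsum]. *)
Lemma cyclic_coefE n d :
  cyclic_coef (n + d) n = qplus d * \sum_(s < n.+1 | (s.*2 <= n)%N)
    q ^+ (tri s + s * d) * qbin (n + d - s) s * qbin (n + d - s.*2) d
    * ((-1) ^+ s * q ^+ (tri s + tri s + s * (n - s.*2)) * gsum (n - s.*2)).
Proof.
pose W s i := q ^+ (tri s + s * d) * qbin (n + d - s) s * qbin (n + d - s.*2) d
    * ((-1) ^+ (n - i) * q ^+ (tri i + tri (n - i)) * qbin (n - s.*2) (i - s)).
transitivity (qplus d * \sum_(i < n.+1) \sum_(s < n.+1)
    (if (s <= i)%N && (s <= n - i)%N then W s i else 0)).
  rewrite mulr_sumr; apply: eq_bigr => -[i /= iN] _.
  set j := (n - i)%N; have -> : n = (i + j)%N by rewrite subnKC.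
  have -> : (i + j + d - i = j + d)%N by lia.
  have -> : (i + j + d - j = i + d)%N by lia.
  rewrite (@sum_ord_widen (fun k => q ^+ tri k * qbin (i + d) k * qbin (i + j + d - k) i)
    (i + d).+1); [|by lia|]; last first.
    by move=> k /andP[ik _]; rewrite (qbin_small ik) mulr0 mul0r.
  rewrite cyclic_inner_sum mulrCA; congr (_ * _).
  rewrite (@sum_ord_widen (fun s => if (s <= i)%N && (s <= j)%N then W s i else 0)
    i.+1); [|by lia|]; last first.
    by move=> s /andP[ik _]; rewrite leqNgt ik.
  rewrite mulr_sumr; apply: eq_bigr => -[s /= si] _.
  rewrite ltnS in si; rewrite si /=.
  case: leqP => sj; last by rewrite (qbin_small sj) !(mulr0, mul0r).
  rewrite /W -/j; have -> : n = (i + j)%N by rewrite subnKC.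
  have := qbin_multinomial d si sj.
  set X := qbin _ s; set Y := qbin _ s => E.
  rewrite -[RHS]mulrA; transitivity ((-1) ^+ j * q ^+ (tri i + tri j) *
    q ^+ (tri s + s * d) * (qbin (j + d) j * (X * qbin (i + j + d - s) (j + d)))).
    by ring.
  by rewrite E; ring.
congr (_ * _); rewrite exchange_big [RHS]big_mkcond /=.
apply: eq_bigr => -[s /= sn] _.
case: leqP => sn2; last first.
  by apply: big1 => i _; case: ifP => // H; exfalso; lia.
rewrite (sum_centered (W s)) // /gsum; set N := (n - s.*2)%N; rewrite !mulr_sumr; apply: eq_bigr => -[a /= aN] _.
rewrite /W -/N addKn.
have -> : (n - (s + a) = s + (N - a))%N by lia.
rewrite !triD [(-1) ^+ (s + _)]exprD.
have -> : (tri s + tri a + s * a + (tri s + tri (N - a) + s * (N - a))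
   = tri s + tri s + s * N + (tri a + tri (N - a)))%N by nia.
by rewrite [q ^+ (tri s + tri s + s * N + _)]exprD; ring.
Qed.

Lemma cyclic_coef_odd L m : (m.*2.+1 <= L)%N -> cyclic_coef L m.*2.+1 = 0.
Proof.
move=> mL; rewrite -(subnKC mL) cyclic_coefE [X in _ * X]big1 ?mulr0 // => s sm.
have -> : (m.*2.+1 - s.*2 = (m - s).*2.+1)%N by lia.
by rewrite gsum_odd !mulr0.
Qed.

Definition coef_form L m :=
  (-1) ^+ m * q ^+ (m * m.+1) * qbin (L - m) m
  * \prod_(r < L - m.*2) (1 + q ^+ (m + r).+1).

Lemma cyclic_coef_even L m : (m.*2 <= L)%N -> cyclic_coef L m.*2 = coef_form L m.
Proof.
move=> mL; rewrite /coef_form; set d := (L - m.*2)%N.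
have -> : L = (m.*2 + d)%N by lia.
have -> : (m.*2 + d - m = m + d)%N by lia.
rewrite -[RHS]mulrA -diagonal_sum mulrCA cyclic_coefE; congr (_ * _).
rewrite mulr_sumr big_mkcond /=.
rewrite (@sum_ord_widen (fun s => if (s.*2 <= m.*2)%N then
    q ^+ (tri s + s * d) * qbin (m.*2 + d - s) s * qbin (m.*2 + d - s.*2) d
    * ((-1) ^+ s * q ^+ (tri s + tri s + s * (m.*2 - s.*2)) * gsum (m.*2 - s.*2)) else 0) m.+1);
  [|by lia|]; last first.
  by move=> s sm; rewrite leq_double leqNgt (_ : (m < s)%N) //; lia.
apply: eq_bigr => -[s /= sm] _; rewrite leq_double (sm : (s <= m)%N).
rewrite -doubleB gsum_even.
have -> : (m * m.+1 = tri s + tri s + s * (m - s).*2 + (m - s) * (m - s).+1)%N.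
  have := triD s s; rewrite addnn.
  have := tri_double s.
  nia.
have -> : (-1) ^+ m = (-1) ^+ s * (-1) ^+ (m - s) :> F by rewrite -exprD subnKC.
by rewrite [in RHS]exprD; ring.
Qed.

Lemma coef_form_small L m : (L < m.*2)%N -> coef_form L m = 0.
Proof. by move=> Lm; rewrite /coef_form qbin_small ?mulr0 ?mul0r //; lia. Qed.

(** * Comparison of the two sides *)

(** Put i = m + t: then [L-m, m+t] [m+t, m] = [L-m, m] [L-2m, t], and the sum
    over t is the q-binomial theorem at q^m. *)
Lemma left_coefE L m :
  (-1) ^+ m * \sum_(i < L.+1) q ^+ (tri i + tri m) * qbin (L - m) i * qbin i m = coef_form L m.
Proof.
have [mL|Lm] := leqP m.*2 L; last first.
  rewrite coef_form_small // big1 ?mulr0 // => i _.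
  have [im|mi] := ltnP i m; first by rewrite (qbin_small im) mulr0.
  by rewrite (@qbin_small (L - m)) ?mulr0 ?mul0r //; lia.
rewrite /coef_form; set d := (L - m.*2)%N.
have -> : (L - m = m + d)%N by lia.
have -> : L.+1 = (m + d.+1 + m)%N by lia.
rewrite !big_split_ord /= big1 ?add0r => [|i _]; last first.
  by rewrite (@qbin_small i m) ?mulr0.
rewrite [X in _ + X]big1 ?addr0 => [|i _]; last first.
  by rewrite (@qbin_small (m + d)) ?mulr0 ?mul0r //; lia.
have -> : \prod_(r < d) (1 + q ^+ (m + r).+1) =
    \sum_(t < d.+1) (q ^+ m) ^+ t * q ^+ tri t * qbin d t.
  by rewrite q_binomial; apply: eq_bigr => r _; rewrite -exprD addnS.
rewrite !mulr_sumr; apply: eq_bigr => -[t /= td] _.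
have qf := qfact_neq0.
rewrite -exprM (mulrAC _ (qbin _ m)) -!mulrA; congr (_ * _).
rewrite [qbin (m + d) (m + t)]qbinE; last by lia.
rewrite !qbinD [qbin d t]qbinE // subnDl.
have -> : (tri (m + t) + tri m = m * m.+1 + m * t + tri t)%N.
  by rewrite triD; have := tri_double m; nia.
by rewrite !exprD; field; rewrite !qf.
Qed.

Lemma sum_even (h : nat -> F) K :
  \sum_(n < K) (if odd n then 0 else h n./2) = \sum_(m < uphalf K) h m.
Proof.
elim: K => [|K IH]; first by rewrite !big_ord0.
rewrite big_ord_recr /= IH uphalf_half; case: ifP => oK; first by rewrite addr0 add1n.
by rewrite add0n [RHS]big_ord_recr.
Qed.

Lemma cyclic_identity (z : F) L :
  \sum_(i < L.+1) \sum_(j < L.+1)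
     q ^+ (tri i + tri j) * (- z ^+ 2) ^+ j * qbin (L - j) i * qbin i j
  = \sum_(i < L.+1) \sum_(j < L.+1) \sum_(k < L.+1)
      (-1) ^+ j * z ^+ (i + j) * q ^+ (tri i + tri j + tri k)
      * qbin (L - i) j * qbin (L - j) k * qbin (L - k) i.
Proof.
rewrite exchange_big /=.
transitivity (\sum_(j < L.+1) z ^+ j.*2 * coef_form L j).
  apply: eq_bigr => j _; rewrite -left_coefE !mulr_sumr; apply: eq_bigr => i _.
  by rewrite [(- _ ^+ 2) ^+ j]exprNn -exprM mul2n; ring.
rewrite (@sum_ord_widen (fun j => z ^+ j.*2 * coef_form L j) (uphalf L.+1)); last 2 first.
- by lia.
- by move=> j jL; rewrite coef_form_small ?mulr0 //; lia.
pose f i j := z ^+ (i + j) * ((-1) ^+ j * q ^+ (tri i + tri j) * qbin (L - i) j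
  * \sum_(k < L.+1) q ^+ tri k * qbin (L - j) k * qbin (L - k) i).
transitivity (\sum_(i < L.+1) \sum_(j < L.+1 - i) f i j); last first.
  apply: eq_bigr => -[i /= iL] _; rewrite -(@sum_ord_widen (f i) _ L.+1) ?leq_subr //; last first.
    by move=> j jL; rewrite /f (@qbin_small (L - i) j) ?(mulr0, mul0r) //; lia.
  apply: eq_bigr => j _; rewrite /f !mulr_sumr; apply: eq_bigr => k _.
  by rewrite !exprD; ring.
rewrite -sum_triangle -(sum_even (fun j => z ^+ j.*2 * coef_form L j)); apply: eq_bigr => -[n /= nL] _.
transitivity (z ^+ n * cyclic_coef L n).
  case: ifP => on; have := odd_double_half n; move: (n./2) => m; rewrite on => En.
    by rewrite -En cyclic_coef_odd ?mulr0 //; lia.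
  by rewrite -En cyclic_coef_even //; lia.
rewrite mulr_sumr; apply: eq_bigr => -[i /= iN] _.
by rewrite /f subnKC.
Qed.

End Qbin.

(** * From sums over all indices to finite ones *)

Lemma qv_not1 n : 1 - qv ^+ n.+1 != 0 :> Qqz.
Proof.
have X1 : 1 - 'X^(n.+1) != 0 :> {poly rat}.
  rewrite -size_poly_gt0 -opprB size_polyN -polyC1 size_XnsubC //.
rewrite /qv -tofracXn -tofrac1 -tofracB tofrac_eq0.
have -> : 1 - ('X : {poly rat})%:P ^+ n.+1 = (1 - 'X^(n.+1))%:P :> {poly {poly rat}}.
  by rewrite polyCB polyC1 polyC_exp.
by rewrite polyC_eq0.
Qed.

(** Applied to each factor of a nonzero summand, this confines the indices to
    a finite box: a negative upper entry forces the coefficient to be 0. *)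
Lemma qbinom_neq0 (F : fieldType) (q : F) (M n : int) : qbinom q M n != 0 -> n <= M.
Proof. by rewrite /qbinom; case: ifP => [/andP[]|_]; rewrite ?eqxx. Qed.

Lemma fsbig_pair (F : nmodType) (f : nat -> nat -> F) K :
  (forall i j, f i j != 0 -> (i < K)%N && (j < K)%N) ->
  \sum_(p \in [set: nat * nat]) (let: (i, j) := p in f i j) = \sum_(i < K) \sum_(j < K) f i j.
Proof.
move=> fK.
rewrite (@fsbigE _ _ _ _ _ [seq (i, j) | i <- iota 0 K, j <- iota 0 K]) //=.
- rewrite big_mkcond big_allpairs_dep -[iota 0 K]val_enum_ord big_map big_enum /=.
  apply: eq_bigr => i _; rewrite big_map big_enum; apply: eq_bigr => j _.
  by rewrite in_setT.
- by rewrite allpairs_uniq ?iota_uniq // => -[a b] [c d].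
move=> [i j] _ ijK; apply/eqP; apply: contraNT ijK => /fK /andP[iK jK].
by apply/allpairsP; exists (i, j); rewrite /= !mem_iota.
Qed.

Lemma fsbig_triple (F : nmodType) (f : nat -> nat -> nat -> F) K :
  (forall i j k, f i j k != 0 -> [&& i < K, j < K & k < K]%N) ->
  \sum_(p \in [set: nat * nat * nat]) (let: (i, j, k) := p in f i j k) =
  \sum_(i < K) \sum_(j < K) \sum_(k < K) f i j k.
Proof.
move=> fK.
rewrite (@fsbigE _ _ _ _ _
  [seq (p, k) | p <- [seq (i, j) | i <- iota 0 K, j <- iota 0 K], k <- iota 0 K]) //=.
- rewrite big_mkcond big_allpairs_dep /= big_allpairs_dep.
  rewrite -[iota 0 K]val_enum_ord big_map big_enum /=.
  apply: eq_bigr => i _; rewrite big_map big_enum; apply: eq_bigr => j _.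
  rewrite big_map big_enum; apply: eq_bigr => k _.
  by rewrite in_setT.
- rewrite !allpairs_uniq ?iota_uniq //; first by move=> -[a b] [c d].
  by move=> -[a b] [c d].
move=> [[i j] k] _ ijK; apply/eqP; apply: contraNT ijK => /fK /and3P[iK jK kK].
apply/allpairsP; exists ((i, j), k); rewrite /= !mem_iota; split=> //.
by apply/allpairsP; exists (i, j); rewrite /= !mem_iota.
Qed.

(* The sums over all of nat * nat and nat * nat * nat are sums over the
   (finite) set of indices with nonzero summand. *)
Theorem mainTheorem2 (L : nat) :
  \sum_(p \in [set: nat * nat])
     (let: (i, j) := p in
      qv ^+ (tri i + tri j) * (- zv ^+ 2) ^+ j
      * qbinom qv (L%:Z - j%:Z) i%:Z * qbinom qv i%:Z j%:Z)
  =
  \sum_(p \in [set: nat * nat * nat])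
     (let: (i, j, k) := p in
      (-1) ^+ j * zv ^+ (i + j) * qv ^+ (tri i + tri j + tri k)
      * qbinom qv (L%:Z - i%:Z) j%:Z
      * qbinom qv (L%:Z - j%:Z) k%:Z
      * qbinom qv (L%:Z - k%:Z) i%:Z).
Proof.
(* The summands vanish unless all indices are at most [L]; there the integer
   differences are the truncated ones of [cyclic_identity]. *)
rewrite (@fsbig_pair _ _ L.+1) => [|i j]; last first.
  rewrite !mulf_eq0 !negb_or => /andP[/andP[_ /qbinom_neq0 ij] /qbinom_neq0 ji].
  by lia.
rewrite (@fsbig_triple _ _ L.+1) => [|i j k]; last first.
  rewrite !mulf_eq0 !negb_or.
  move=> /andP[/andP[/andP[_ /qbinom_neq0 ?] /qbinom_neq0 ?] /qbinom_neq0 ?].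
  by lia.
transitivity (\sum_(i < L.+1) \sum_(j < L.+1)
     qv ^+ (tri i + tri j) * (- zv ^+ 2) ^+ j * qbinom qv (L - j)%N i * qbinom qv i j).
  by apply: eq_bigr => i _; apply: eq_bigr => -[j /= jL] _; rewrite -subzn.
rewrite (cyclic_identity qv_not1).
apply: eq_bigr => -[i /= iL] _; apply: eq_bigr => -[j /= jL] _.
apply: eq_bigr => -[k /= kL] _.
by rewrite -!subzn.
Qed.
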